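(* For $n\ge 2$ let $b_n=|P(n)|$ be the number of prime expressions in $L(n)$ (the operadic generators of $\mathrm{Lie}$ in arity $n$), and let $B(x)=-x+\sum_{n=2}^{\infty} b_n x^n$. Then the formal power series $B(x)$ satisfies the differential equation $$xB'(x)+(B'(x)+B(x))B(x)=0,$$ and the following recursive formula holds: $$b_2=1,\qquad b_n=\sum_{k=2}^{n-2}\big((k+1)b_{k+1}+b_k\big)b_{n-k}\quad\text{for } n\ge 3$$ (where the empty sum is $0$).
   Context: For $k\ge 1$, $L(k)$ is the set of formal expressions obtained by applying iterated binary brackets $[\cdot,\cdot]$ to the $k$ symbols $x_1,\dots,x_k$ such that: (1) each symbol appears exactly once; (2) for each bracket occurring in the expression, the smallest index inside that bracket appears on its left hand side and the largest index inside that bracket appears on its right hand side. For example $L(1)=\{x_1\}$, $L(2)=\{[x_1,x_2]\}$, $L(3)=\{[x_1,[x_2,x_3]],[[x_1,x_2],x_3]\}$. A bracket of an expression $A\in L(n)$ is called connected if the set of indices of the symbols inside it is an interval of consecutive integers (the indices need not appear in increasing order). For $n\ge 2$, an expression $A\in L(n)$ is called prime if its outer bracket is the only connected bracket it contains. $P(n)\subset L(n)$ denotes the set of prime expressions in $n$ symbols. For example $[[x_1,x_3],[[x_2,x_4],x_5]]$ is prime, while $[[[x_1,x_3],[x_2,x_4]],x_5]$ is not. *)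

(* Defs.v *)
From HB Require Import structures.
From mathcomp Require Import all_boot all_order all_algebra.
From mathcomp Require Import finmap.
Set Implicit Arguments.
Unset Strict Implicit.
Unset Printing Implicit Defensive.

Inductive expr : Type :=
| Sym of nat
| Br of expr & expr.

Fixpoint tree_of_expr (A : expr) : GenTree.tree nat :=
  match A with
  | Sym i => GenTree.Leaf i
  | Br l r => GenTree.Node 0 [:: tree_of_expr l; tree_of_expr r]
  end.

Fixpoint expr_of_tree (t : GenTree.tree nat) : option expr :=
  match t with
  | GenTree.Leaf i => Some (Sym i)
  | GenTree.Node _ [:: l; r] =>
      if (expr_of_tree l, expr_of_tree r) is (Some A, Some B)
      then Some (Br A B) else None
  | _ => None
  end.

Lemma tree_of_exprK : pcancel tree_of_expr expr_of_tree.
Proof. by elim=> //= l -> r ->. Qed.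

HB.instance Definition _ := Countable.copy expr (pcan_type tree_of_exprK).

Fixpoint indices (A : expr) : seq nat :=
  if A is Br l r then indices l ++ indices r else
  if A is Sym i then [:: i] else [::].

Fixpoint min_index (A : expr) : nat :=
  match A with
  | Sym i => i
  | Br l r => minn (min_index l) (min_index r)
  end.

Fixpoint max_index (A : expr) : nat :=
  match A with
  | Sym i => i
  | Br l r => maxn (max_index l) (max_index r)
  end.

(* Every bracket occurring in A, including the outer one (which comes first). *)
Fixpoint brackets (A : expr) : seq expr :=
  if A is Br l r then A :: brackets l ++ brackets r else [::].

Definition well_sided (A : expr) : bool :=
  if A is Br l r
  then (min_index A \in indices l) && (max_index A \in indices r)
  else true.

Definition in_L (n : nat) (A : expr) : bool :=
  perm_eq (indices A) (iota 1 n) && all well_sided (brackets A).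

Definition connected (A : expr) : bool :=
  all [in indices A] (index_iota (min_index A) (max_index A).+1).

(* As symbols do not repeat in an element of L(n), distinct bracket occurrences
   are distinct expressions; a lone symbol contains no bracket, hence is not
   prime. *)
Definition prime_expr (A : expr) : bool :=
  [seq C <- brackets A | connected C] == [:: A].

(* All expressions of height at most h in the symbols x_1, ..., x_n. *)
Fixpoint exprs (n h : nat) : seq expr :=
  if h is h'.+1
  then exprs n h' ++ [seq Br l r | l <- exprs n h', r <- exprs n h']
  else [seq Sym i | i <- iota 1 n].

(* An expression with n leaves has height less than n, so the height bound
   excludes nothing; see mem_L. *)
Definition L (n : nat) : {fset expr} := [fset A in exprs n n | in_L n A]%fset.

Lemma exprs_le n h k : h <= k -> {subset exprs n h <= exprs n k}.
Proof.
move=> /subnK <-; elim: (k - h) => [|d IHd] A //= /IHd.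
by rewrite mem_cat => ->.
Qed.

Lemma size_indices_gt0 A : 0 < size (indices A).
Proof. by elim: A => //= l IHl r _; rewrite size_cat ltn_addr. Qed.

Lemma mem_exprs n A :
  {subset indices A <= iota 1 n} -> A \in exprs n (size (indices A)).-1.
Proof.
elim: A => [i|l IHl r IHr] /= sub.
  by rewrite map_f // sub ?mem_head.
have{} IHl: l \in exprs n (size (indices l)).-1.
  by apply: IHl => i il; apply: sub; rewrite mem_cat il.
have{} IHr: r \in exprs n (size (indices r)).-1.
  by apply: IHr => i ir; apply: sub; rewrite mem_cat ir orbT.
have := size_indices_gt0 l; have := size_indices_gt0 r; rewrite size_cat.
case: (size (indices r)) IHr => // p rp _.
case: (size (indices l)) IHl => // q lq _.
rewrite addnS /= mem_cat; apply/orP; right.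
apply/allpairsP; exists (l, r); split=> //=.
- by apply: exprs_le lq; rewrite leq_addr.
- by apply: exprs_le rp; rewrite leq_addl.
Qed.

Lemma mem_L n A : (A \in L n) = in_L n A.
Proof.
rewrite !inE /=; apply: andb_idl => /andP[Ap _].
apply: (@exprs_le _ n.-1 n); first exact: leq_pred.
rewrite -[in n.-1](size_iota 1 n) -(perm_size Ap).
by apply: mem_exprs => i; rewrite (perm_mem Ap).
Qed.

Definition P (n : nat) : {fset expr} := [fset A in L n | prime_expr A]%fset.

Definition b (n : nat) : nat := #|` P n|.

Import GRing.Theory.
Local Open Scope ring_scope.

(* The formal power series \sum_n (f n) x^n is represented by its coefficient
   sequence f; equality of power series is [=1]. *)
Definition fps (R : comNzRingType) : Type := nat -> R.

Section FormalPowerSeries.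
Variable R : comNzRingType.
Implicit Types f g : fps R.

Definition fps_zero : fps R := fun _ => 0.
Definition fps_X : fps R := fun n => (n == 1)%:R.
Definition fps_add f g : fps R := fun n => f n + g n.
Definition fps_mul f g : fps R := fun n => \sum_(i < n.+1) f i * g (n - i)%N.
Definition fps_deriv f : fps R := fun n => f n.+1 *+ n.+1.

End FormalPowerSeries.

Arguments fps_zero {R}.
Arguments fps_X {R}.

Declare Scope fps_scope.
Delimit Scope fps_scope with fps.
Bind Scope fps_scope with fps.
Notation "0" := fps_zero : fps_scope.
Notation "''X'" := fps_X : fps_scope.
Notation "f + g" := (fps_add f g) : fps_scope.
Notation "f * g" := (fps_mul f g) : fps_scope.
Notation "f ^` ()" := (fps_deriv f) : fps_scope.

Definition Bseries : fps int := fun n =>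
  match n with
  | 0 => 0
  | 1 => -1
  | _ => (b n)%:Z
  end.

(* Main.v *)
Require Import Defs.
From mathcomp Require Import all_boot all_order all_algebra.
From mathcomp Require Import finmap.
From mathcomp Require Import zify ring.

(** The equation comes from two ways of counting L(n).

    On the one hand [|L(n)| = (n-1)!].  Reading an expression as a word turns
    L(n) into the set of permutations of 1, ..., n that begin with 1
    ([word_inj], [word_surj], [card_L_at]): a bracket [[l, r]] is read either
    from its minimum, as the word of l begun at its minimum followed by the word
    of r begun at its maximum, or from its maximum, in the opposite order.  The
    letter where the second factor begins is the maximum (resp. minimum) of the
    whole word, so the cut can be found again.

    On the other hand L is freely generated, as a nonsymmetric operad, by the
    prime expressions.  For n >= 2 the maximal proper connected brackets and the
    remaining symbols of A in L(n) are consecutive intervals of indices (a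
    chain), and shrinking each of them to a symbol leaves a prime expression.
    Conversely a prime p in P(k) and a chain of k expressions are recovered from
    the expression obtained by substituting the chain into p ([subst_inj],
    [subst_surj]), because substituting an increasing chain of intervals changes
    neither which brackets of p are connected ([connected_subst]) nor on which
    side of a bracket its extreme indices lie ([well_sided_subst]).

    With A(x) the series of the (n-1)! x^n, n >= 1, the second count reads
    B(A(x)) = -x, and the first gives A = x + x^2 A'.  Differentiating B(A) = -x
    yields B'(A) A' = -1, hence
      (A B'(A) + (B'(A) + B(A)) B(A)) A' = -A + x + x^2 A' = 0.
    As A' has constant term 1, x B' + (B' + B) B vanishes once A is substituted
    for x, and then it is zero because A has order one ([comp_low_coef0]).  This
    is carried out on polynomials modulo a power of x ([Bpoly_ODE]).  The
    recursion is the equation read coefficientwise. *)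

Set Implicit Arguments.
Unset Strict Implicit.
Unset Printing Implicit Defensive.

(** * Expressions as words *)

Definition all_well_sided (A : expr) : bool := all well_sided (brackets A).

(** Reading words from the minimum and from the maximum are mirror images; the
    direction d ([true] for the minimum) lets one proof serve both. *)
Definition extreme (d : bool) (A : expr) : nat :=
  if d then min_index A else max_index A.

Definition ord_dir (d : bool) (i j : nat) : bool :=
  if d then i <= j else j <= i.

Lemma extreme_mem d A : extreme d A \in indices A.
Proof.
rewrite /extreme; case: d; elim: A => [i|l IHl r IHr] /=; rewrite ?mem_head //.
  by rewrite mem_cat /minn; case: ifP => _; rewrite ?IHl ?IHr ?orbT.
by rewrite mem_cat /maxn; case: ifP => _; rewrite ?IHl ?IHr ?orbT.
Qed.

Lemma extreme_ord d A i : i \in indices A -> ord_dir d (extreme d A) i.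
Proof.
rewrite /extreme /ord_dir; case: d; elim: A => [j|l IHl r IHr] /=;
  rewrite ?inE ?mem_cat; try by move=> /eqP->.
  by case/orP=> [/IHl|/IHr]; lia.
by case/orP=> [/IHl|/IHr]; lia.
Qed.

Lemma ord_dir_anti d i j : ord_dir d i j -> ord_dir d j i -> i = j.
Proof. by rewrite /ord_dir; case: d; lia. Qed.

Lemma extremeE d A x :
  x \in indices A -> {in indices A, forall i, ord_dir d x i} -> extreme d A = x.
Proof.
move=> xA xP; apply: (@ord_dir_anti d); first exact: extreme_ord.
exact/xP/extreme_mem.
Qed.

Lemma eq_extreme d A A' : indices A =i indices A' -> extreme d A = extreme d A'.
Proof.
move=> eqA; apply: extremeE => [|i]; rewrite eqA; first exact: extreme_mem.
exact: extreme_ord.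
Qed.

(** The word of A begins with [extreme d A] ([head_word]).  The second factor is
    read in the opposite direction, so that it begins with the other extreme
    index of the whole word, which marks where the first factor ends. *)
Fixpoint word (d : bool) (A : expr) : seq nat :=
  match A with
  | Sym i => [:: i]
  | Br l r =>
      if d then word d l ++ word (~~ d) r else word d r ++ word (~~ d) l
  end.

Definition child (d : bool) (l r : expr) : expr := if d then l else r.

Lemma word_Br d l r :
  word d (Br l r) = word d (child d l r) ++ word (~~ d) (child (~~ d) l r).
Proof. by case: d. Qed.

Lemma perm_word d A : perm_eq (word d A) (indices A).
Proof.
elim: A d => //= l IHl r IHr [] /=; first exact: perm_cat.
by rewrite perm_catC perm_cat.
Qed.

Lemma all_well_sided_Br l r :
  all_well_sided (Br l r) =
  [&& well_sided (Br l r), all_well_sided l & all_well_sided r].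
Proof. by rewrite /all_well_sided /= all_cat. Qed.

Lemma all_well_sided_root l r : all_well_sided (Br l r) -> well_sided (Br l r).
Proof. by rewrite all_well_sided_Br; case/and3P. Qed.

Lemma well_sided_extreme d l r :
  well_sided (Br l r) -> extreme d (Br l r) \in indices (child d l r).
Proof. by case/andP; case: d. Qed.

Lemma extreme_child d l r :
  well_sided (Br l r) -> extreme d (child d l r) = extreme d (Br l r).
Proof.
move=> /well_sided_extreme ws; apply: extremeE => // i i_c.
by apply: extreme_ord; rewrite /= mem_cat; case: (d) i_c => ->; rewrite ?orbT.
Qed.

Lemma all_well_sided_child d l r :
  all_well_sided (Br l r) -> all_well_sided (child d l r).
Proof. by rewrite all_well_sided_Br; case/and3P; case: d. Qed.

Lemma head_word d A : all_well_sided A -> head 0 (word d A) = extreme d A.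
Proof.
elim: A d => [i|l IHl r IHr] d; first by case: d.
rewrite word_Br => ws.
have wsA := all_well_sided_root ws.
rewrite -extreme_child //; have wsc := all_well_sided_child d ws.
have <- : head 0 (word d (child d l r)) = extreme d (child d l r).
  by case: (d) wsc; [apply: IHl | apply: IHr].
have := size_indices_gt0 (child d l r); rewrite -(perm_size (perm_word d _)).
by case: (word d _).
Qed.

(** The second factor begins with the opposite extreme, which does not occur in
    the first: the cut between the factors is visible on the word itself. *)
Lemma index_second d l r :
    all_well_sided (Br l r) -> uniq (indices (Br l r)) ->
  index (extreme (~~ d) (Br l r)) (word d (Br l r)) =
    size (word d (child d l r)).
Proof.
move=> ws; rewrite -(perm_uniq (perm_word d _)) word_Br cat_uniq.
case/and3P=> _ /hasPn disj _.
have wsA := all_well_sided_root ws.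
rewrite index_cat -extreme_child // -head_word ?all_well_sided_child //.
have := size_indices_gt0 (child (~~ d) l r).
rewrite -(perm_size (perm_word (~~ d) _)).
case: (word (~~ d) _) disj => //= x w disj _.
by rewrite (negPf (disj x (mem_head _ _))) eqxx addn0.
Qed.

(** The words of the two sides are read off the cut, and determine the sides. *)
Lemma word_inj d A A' :
    all_well_sided A -> uniq (indices A) -> all_well_sided A' ->
  word d A = word d A' -> A = A'.
Proof.
have sz2 e l r : size (word e (Br l r)) != 1.
  rewrite (perm_size (perm_word _ _)) /= size_cat.
  by have := size_indices_gt0 l; have := size_indices_gt0 r; lia.
elim: A d A' => [i|l IHl r IHr] d [i'|l' r'] ws un ws' eqw.
- by case: eqw => ->.
- by have := sz2 d l' r'; rewrite -eqw.
- by have := sz2 d l r; rewrite eqw.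
have un' : uniq (indices (Br l' r')).
  by rewrite -(perm_uniq (perm_word d _)) -eqw (perm_uniq (perm_word d _)).
have eqx : extreme (~~ d) (Br l r) = extreme (~~ d) (Br l' r').
  apply: eq_extreme => i.
  by rewrite -(perm_mem (perm_word d _)) eqw (perm_mem (perm_word d _)).
have eqs : size (word d (child d l r)) = size (word d (child d l' r')).
  by rewrite -!index_second // eqx eqw.
move/eqP: eqw; rewrite !word_Br eqseq_cat // => /andP[/eqP eq1 /eqP eq2].
move: (all_well_sided_child true ws) (all_well_sided_child false ws).
move: (all_well_sided_child true ws') (all_well_sided_child false ws').
move: un; rewrite /= cat_uniq => /and3P[ul _ ur] wl' wr' wl wr.
case: d eq1 eq2 {eqx eqs} => /= eq1 eq2.
  by rewrite (IHl _ _ wl ul wl' eq1) (IHr _ _ wr ur wr' eq2).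
by rewrite (IHl _ _ wl ul wl' eq2) (IHr _ _ wr ur wr' eq1).
Qed.

Lemma ex_extreme d (x : nat) (w : seq nat) :
  exists2 M, M \in x :: w & {in x :: w, forall i, ord_dir d M i}.
Proof.
elim: w x => [|y w IH] x.
  exists x; rewrite ?mem_head // => i.
  by rewrite inE /ord_dir => /eqP->; case: d.
have [M Mw MP] := IH y; case: (boolP (ord_dir d x M)) => xM.
  exists x => [|i]; first exact: mem_head.
  rewrite inE => /predU1P[->|/MP]; first by rewrite /ord_dir; case: (d).
  by move: xM; rewrite /ord_dir; case: (d); lia.
exists M => [|i]; first by rewrite inE Mw orbT.
rewrite inE => /predU1P[->|/MP//].
by move: xM; rewrite /ord_dir; case: (d); lia.
Qed.

(** Cut the word at its opposite extreme M, which is not the first letter: both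
    factors begin with an extreme letter, in opposite directions. *)
Lemma word_surj d (x : nat) (w : seq nat) :
    uniq (x :: w) -> {in x :: w, forall i, ord_dir d x i} ->
  exists2 A, all_well_sided A & word d A = x :: w.
Proof.
have [n] := ubnP (size w); elim: n d x w => // n IHn d x w /ltnSE sz un xP.
case: w sz un xP => [|y w] sz un xP; first by exists (Sym x).
have [M Mw MP] := ex_extreme (~~ d) x (y :: w).
have yx : y != x by move: un; rewrite /= inE eq_sym; case: eqP.
have Mx : M != x.
  apply/eqP=> eqM; move/eqP: yx; apply; apply: (@ord_dir_anti d).
    by move: (MP y); rewrite eqM !inE eqxx orbT /ord_dir; case: (d) => /(_ isT).
  by apply: xP; rewrite !inE eqxx orbT.
move: Mw; rewrite inE (negPf Mx) /= => Mw.
case/splitPr: Mw sz un xP MP => w1 w2 sz un xP MP {y w yx Mx}.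
rewrite size_cat /= in sz.
have [|||A1 ws1 e1] := IHn d x w1.
- lia.
- by move: un; rewrite -cat_cons cat_uniq; case/and3P.
- by move=> i iw; apply: xP; rewrite -cat_cons mem_cat iw.
have [|||A2 ws2 e2] := IHn (~~ d) M w2.
- lia.
- by move: un; rewrite -cat_cons cat_uniq; case/and3P.
- by move=> i iw; apply: MP; rewrite -cat_cons mem_cat iw orbT.
have m1 i : (i \in indices A1) = (i \in x :: w1).
  by rewrite -(perm_mem (perm_word d A1)) e1.
have m2 i : (i \in indices A2) = (i \in M :: w2).
  by rewrite -(perm_mem (perm_word (~~ d) A2)) e2.
pose A := Br (child d A1 A2) (child d A2 A1).
have mA i : (i \in indices A) = (i \in x :: w1 ++ M :: w2).
  rewrite /= mem_cat -cat_cons mem_cat; case: (d); rewrite m1 m2 //.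
  by rewrite orbC.
have exx : extreme d A = x.
  by apply: extremeE => [|i]; rewrite mA ?mem_head //; apply: xP.
have exM : extreme (~~ d) A = M.
  apply: extremeE => [|i]; rewrite mA; last exact: MP.
  by rewrite -cat_cons mem_cat mem_head orbT.
exists A; last by rewrite word_Br; case: (d) e1 e2 => /= -> ->.
rewrite all_well_sided_Br /well_sided -/A.
move: exx exM; rewrite /A /child /extreme; case: (d) => /= -> ->;
  by rewrite m1 m2 !mem_head ws1 ws2.
Qed.

(** L(n) relabelled on m, ..., m + n - 1: blocks of an expression keep their
    labels, which saves shifting indices when substituting. *)
Definition L_at (m n : nat) : {fset expr} :=
  [fset A in exprs (m + n) n |
     perm_eq (indices A) (iota m n) && all_well_sided A]%fset.

Lemma mem_L_at m n A : 0 < m ->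
  (A \in L_at m n) = perm_eq (indices A) (iota m n) && all_well_sided A.
Proof.
move=> m0; rewrite !inE /=; apply: andb_idl => /andP[Ap _].
apply: (@exprs_le _ n.-1 n); first exact: leq_pred.
rewrite -[in n.-1](size_iota m n) -(perm_size Ap).
by apply: mem_exprs => i; rewrite (perm_mem Ap) !mem_iota; lia.
Qed.

Lemma L_at1 n : L_at 1 n = L n.
Proof. by apply/fsetP=> A; rewrite mem_L mem_L_at. Qed.

Lemma card_L_at m n : 0 < m -> #|` L_at m n.+1| = n`!.
Proof.
move=> m0; rewrite -[in RHS](size_iota m.+1 n) -size_permutations ?iota_uniq //.
rewrite -(size_map (word true)) -[RHS](size_map (cons m)).
apply/perm_size/uniq_perm.
- rewrite map_inj_in_uniq ?fset_uniq // => A A'.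
  rewrite !mem_L_at // => /andP[pA wA] /andP[pA' wA'].
  by apply: word_inj; rewrite // (perm_uniq pA) iota_uniq.
- by rewrite map_inj_uniq ?permutations_uniq // => u v [].
move=> w; apply/mapP/mapP=> [[A]|[v]].
  rewrite mem_L_at // => /andP[pA wA] ->.
  have pw : perm_eq (word true A) (m :: iota m.+1 n).
    exact: perm_trans (perm_word _ _) pA.
  have := head_word true wA; have -> : extreme true A = m.
    apply: extremeE => [|i]; rewrite (perm_mem pA) mem_iota; first lia.
    by rewrite /ord_dir; lia.
  case: (word true A) pw => [|x v] pw; first by have := perm_size pw.
  rewrite /= => xm; subst x; exists v => //.
  by rewrite mem_permutations; move: pw; rewrite perm_cons.
rewrite mem_permutations => pv ->.
have mv i : i \in m :: v -> m <= i.
  by rewrite inE (perm_mem pv) mem_iota; lia.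
have [||A wA eA] := @word_surj true m v; last exists A => //.
- by rewrite /= (perm_uniq pv) iota_uniq (perm_mem pv) mem_iota ltnn.
- exact: mv.
rewrite mem_L_at // wA andbT -(permPl (perm_word true A)) eA.
by rewrite -[n.+1]/(1 + n) iotaD addn1 perm_cons.
Qed.

(** * Connected brackets *)

(** Convexity of the set of indices: unlike the definition of [connected], this
    form is visibly transported by monotone maps. *)
Lemma connectedP A :
  reflect {in indices A &, forall u w v, u <= v <= w -> v \in indices A}
          (connected A).
Proof.
apply: (iffP allP) => [conn u w uA wA v uvw | conn v].
  apply: conn; rewrite mem_index_iota.
  have := extreme_ord true uA; have := extreme_ord false wA.
  by rewrite /ord_dir /extreme; lia.
rewrite mem_index_iota => v_in.
by apply: (conn _ _ (extreme_mem true A) (extreme_mem false A));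
  rewrite /extreme; lia.
Qed.

Lemma connected_iota A m n : perm_eq (indices A) (iota m n) -> connected A.
Proof.
move=> pA; apply/connectedP=> u w + + v.
by rewrite !(perm_mem pA) !mem_iota; lia.
Qed.

Lemma connected_perm_iota A :
    uniq (indices A) -> connected A ->
  perm_eq (indices A) (iota (min_index A) (size (indices A))).
Proof.
move=> un /connectedP conn.
have pA : perm_eq (indices A) (index_iota (min_index A) (max_index A).+1).
  apply: uniq_perm => // [|v]; first exact: iota_uniq.
  rewrite mem_index_iota; apply/idP/idP => [vA|v_in].
    have := extreme_ord true vA; have := extreme_ord false vA.
    by rewrite /ord_dir /extreme; lia.
  by apply: (conn _ _ (extreme_mem true A) (extreme_mem false A));
  rewrite /extreme; lia.
by rewrite [in iota _ (size _)](perm_size pA) size_iota.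
Qed.

Lemma connected_Sym i : connected (Sym i).
Proof. exact: (@connected_iota _ i 1). Qed.

(** * Chains *)

(** The operands to be plugged into an expression, each with its labels already
    moved to the interval that it occupies after substitution. *)
Fixpoint chain (m n : nat) (s : seq expr) : bool :=
  if s is A :: s' then
    let j := size (indices A) in
    [&& j <= n, A \in L_at m j & chain (m + j) (n - j) s']
  else n == 0.

Definition precedes (A B : expr) : bool := max_index A < min_index B.

Lemma chain_perm m n s :
  0 < m -> chain m n s -> perm_eq (flatten (map indices s)) (iota m n).
Proof.
elim: s m n => [|A s IH] m n m0 /=; first by move/eqP->.
case/and3P=> jn; rewrite mem_L_at // => /andP[pA _] /IH ps.
by rewrite -(subnKC jn) iotaD; apply: perm_cat => //; apply: ps; lia.
Qed.

Lemma chain_all m n s :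
  0 < m -> chain m n s -> all (fun A => connected A && all_well_sided A) s.
Proof.
elim: s m n => //= A s IH m n m0.
case/and3P=> _; rewrite mem_L_at // => /andP[pA ->] /IH ->; last lia.
by rewrite (connected_iota pA).
Qed.

Lemma chain_pairwise m n s : 0 < m -> chain m n s -> pairwise precedes s.
Proof.
elim: s m n => //= A s IH m n m0.
case/and3P=> _; rewrite mem_L_at // => /andP[pA _] cs.
have m0' : 0 < m + size (indices A) by lia.
rewrite (IH _ _ m0' cs) andbT; apply/allP=> B Bs; rewrite /precedes.
have : max_index A \in iota m (size (indices A)).
  by rewrite -(perm_mem pA); apply: (extreme_mem false).
have : min_index B \in iota (m + size (indices A)) (n - size (indices A)).
  rewrite -(perm_mem (chain_perm m0' cs)); apply/flatten_mapP.
  by exists B => //; apply: (extreme_mem true).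
by rewrite !mem_iota; lia.
Qed.

(** Disjoint connected expressions that cover an interval form a chain once
    sorted; this is how the blocks of an expression become operands. *)
Lemma chain_intro m n s :
    0 < m -> perm_eq (flatten (map indices s)) (iota m n) ->
    all (fun A => connected A && all_well_sided A) s ->
    sorted (relpre min_index leq) s ->
  chain m n s.
Proof.
elim: s m n => [|A s IH] m n m0 /=; first by case: n => // n /perm_size.
move=> pf /andP[/andP[cA wA] alls] srt.
have un : uniq (indices A ++ flatten (map indices s)).
  by rewrite (perm_uniq pf) iota_uniq.
(* The smallest index of all lies in the first expression, which is thus an
   initial segment. *)
have mA : min_index A = m.
  have minA : min_index A \in iota m n.
    by rewrite -(perm_mem pf) mem_cat (extreme_mem true A).
  have : m \in iota m n by move: minA; rewrite !mem_iota; lia.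
  rewrite -(perm_mem pf) mem_cat; move: minA; rewrite mem_iota => minA.
  case/orP=> [mA|/flatten_mapP[B Bs mB]].
    by have := extreme_ord true mA; rewrite /ord_dir /extreme; lia.
  have := extreme_ord true mB; rewrite /ord_dir /extreme.
  have := order_path_min (fun _ _ _ => @leq_trans _ _ _) srt.
  move=> /allP/(_ B Bs) /=.
  lia.
have uA : uniq (indices A) by move: un; rewrite cat_uniq; case/andP.
have pA : perm_eq (indices A) (iota m (size (indices A))).
  by rewrite -mA; apply: connected_perm_iota.
have jn : size (indices A) <= n.
  by rewrite -[leqRHS](size_iota m n) -(perm_size pf) size_cat leq_addr.
rewrite jn mem_L_at // pA wA /=; apply: IH => //; first lia.
  move: pf; rewrite -[in iota m n](subnKC jn) iotaD => pf.
  rewrite -(perm_cat2l (iota m (size (indices A)))) -(permPr pf).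
  by rewrite perm_cat2r perm_sym.
exact: path_sorted srt.
Qed.

Lemma chain_sorted m n s :
  0 < m -> chain m n s -> sorted (relpre min_index ltn) s.
Proof.
move=> m0 /(chain_pairwise m0)/pairwise_sorted; apply: sub_sorted => A B /=.
have := extreme_ord true (extreme_mem false A).
by rewrite /precedes /ord_dir /extreme; lia.
Qed.

Lemma chain_uniq m n s : 0 < m -> chain m n s -> uniq s.
Proof.
move=> m0 /(chain_sorted m0); apply: sorted_uniq => [A B C|A] /=.
  exact: ltn_trans.
exact: ltnn.
Qed.

(** The order of a chain is forced by its labels, so the unordered collection of
    blocks determines the chain. *)
Lemma chain_mem_eq m n s m' n' s' :
  0 < m -> 0 < m' -> chain m n s -> chain m' n' s' -> s =i s' -> s = s'.
Proof.
move=> m0 m0' /(chain_sorted m0) cs /(chain_sorted m0').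
apply: irr_sorted_eq cs => [A B C|A] /=; first exact: ltn_trans.
exact: ltnn.
Qed.

(** * Substitution *)

(** Symbols are numbered from 1, lists from 0. *)
Definition piece (s : seq expr) (i : nat) : expr := nth (Sym 0) s i.-1.

Fixpoint subst (s : seq expr) (C : expr) : expr :=
  match C with
  | Sym i => piece s i
  | Br l r => Br (subst s l) (subst s r)
  end.

Lemma indices_subst s C :
  indices (subst s C) = flatten [seq indices (piece s i) | i <- indices C].
Proof.
by elim: C => [i|l IHl r IHr] /=; rewrite ?cats0 // map_cat flatten_cat IHl IHr.
Qed.

Definition labelled (s : seq expr) (C : expr) : bool :=
  all (fun i => 0 < i <= size s) (indices C).

Lemma piece_in s i : 0 < i <= size s -> piece s i \in s.
Proof. by case: i => //= i; apply: mem_nth. Qed.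

Lemma labelled_Br s l r : labelled s (Br l r) = labelled s l && labelled s r.
Proof. by rewrite /labelled /= all_cat. Qed.

(** Together with [piece_cover], this makes sending a label to the number of
    its piece a monotone map onto 1, ..., size s, under which the labels of
    [subst s C] are the preimage of the indices of C.  All the invariance
    properties of substitution below follow from this. *)
Lemma piece_mono n s i j u v :
    chain 1 n s -> 0 < i <= size s -> 0 < j <= size s ->
    u \in indices (piece s i) -> v \in indices (piece s j) -> u <= v -> i <= j.
Proof.
move=> cs i_s j_s ui vj uv; rewrite leqNgt; apply/negP=> ji.
have /(pairwiseP (Sym 0))/(_ j.-1 i.-1) := chain_pairwise (ltn0Sn 0) cs.
rewrite !inE /precedes => /(_ ltac:(lia) ltac:(lia) ltac:(lia)).
have := extreme_ord true ui; have := extreme_ord false vj.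
by rewrite /ord_dir /extreme /piece; lia.
Qed.

Lemma piece_inj n s i j u :
    chain 1 n s -> 0 < i <= size s -> 0 < j <= size s ->
    u \in indices (piece s i) -> u \in indices (piece s j) -> i = j.
Proof.
move=> cs i_s j_s ui uj; have := piece_mono cs i_s j_s ui uj (leqnn u).
by have := piece_mono cs j_s i_s uj ui (leqnn u); lia.
Qed.

Lemma piece_cover n s v :
  chain 1 n s -> 0 < v <= n ->
  exists2 i, 0 < i <= size s & v \in indices (piece s i).
Proof.
move=> cs v_n; have : v \in iota 1 n by rewrite mem_iota; lia.
rewrite -(perm_mem (chain_perm (ltn0Sn 0) cs)) => /flatten_mapP[A As vA].
exists (index A s).+1; first by rewrite /= index_mem.
by rewrite /piece nth_index.
Qed.

Lemma piece_range n s i v :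
  chain 1 n s -> 0 < i <= size s -> v \in indices (piece s i) -> 0 < v <= n.
Proof.
move=> cs i_s vi; have : v \in iota 1 n; last by rewrite mem_iota; lia.
rewrite -(perm_mem (chain_perm (ltn0Sn 0) cs)); apply/flatten_mapP.
by exists (piece s i) => //; apply: piece_in.
Qed.

Lemma mem_subst s C v :
  reflect (exists2 i, i \in indices C & v \in indices (piece s i))
          (v \in indices (subst s C)).
Proof. by rewrite indices_subst; apply: flatten_mapP. Qed.

(** Preimages and images of convex sets under a monotone surjection are
    convex. *)
Lemma connected_subst n s C :
  chain 1 n s -> labelled s C -> connected (subst s C) = connected C.
Proof.
move=> cs /allP lC; apply/connectedP/connectedP.
  move=> conn i l iC lC' j /andP[ij jl].
  have [eij|nij] := eqVneq i j; first by rewrite -eij.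
  have [ejl|njl] := eqVneq j l; first by rewrite ejl.
  have := lC _ iC; have := lC _ lC' => l_s i_s.
  have j_s : 0 < j <= size s by lia.
  have ui := extreme_mem true (piece s i).
  have vj := extreme_mem true (piece s j).
  have wl := extreme_mem true (piece s l).
  have /mem_subst[j' j'C vj'] :
      extreme true (piece s j) \in indices (subst s C).
    apply: (conn (extreme true (piece s i)) (extreme true (piece s l))).
    - by apply/mem_subst; exists i.
    - by apply/mem_subst; exists l.
    apply/andP; split; rewrite leqNgt; apply/negP=> /ltnW.
      by move/(piece_mono cs j_s i_s vj ui); lia.
    by move/(piece_mono cs l_s j_s wl vj); lia.
  by rewrite (piece_inj cs j_s (lC _ j'C) vj vj').
move=> conn u w /mem_subst[i iC ui] /mem_subst[l lC' wl] v /andP[uv vw].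
have i_s := lC _ iC; have l_s := lC _ lC'.
have [|j j_s vj] := @piece_cover n s v cs.
  by have := piece_range cs i_s ui; have := piece_range cs l_s wl; lia.
apply/mem_subst; exists j => //; apply: (conn i l) => //.
by rewrite (piece_mono cs i_s j_s ui vj uv) (piece_mono cs j_s l_s vj wl vw).
Qed.

(** A monotone map sends an extreme of the preimage to the extreme of the
    image. *)
Lemma extreme_subst n s C d :
  chain 1 n s -> labelled s C ->
  extreme d (subst s C) \in indices (piece s (extreme d C)).
Proof.
move=> cs /allP lC; have /mem_subst[i iC ei] := extreme_mem d (subst s C).
suff -> : extreme d C = i by [].
apply: extremeE => // j jC.
have xj := extreme_mem true (piece s j).
have : extreme true (piece s j) \in indices (subst s C).
  by apply/mem_subst; exists j.
move/(extreme_ord d); move: ei; rewrite /ord_dir; case: (d) => ei ex.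
  exact: (piece_mono cs (lC _ iC) (lC _ jC) ei xj ex).
exact: (piece_mono cs (lC _ jC) (lC _ iC) xj ei ex).
Qed.

Lemma well_sided_subst n s l r :
  chain 1 n s -> labelled s (Br l r) ->
  well_sided (subst s (Br l r)) = well_sided (Br l r).
Proof.
move=> cs lC; have := lC; rewrite labelled_Br => /andP[ll lr].
have key d : (extreme d (subst s (Br l r)) \in indices (subst s (child d l r)))
           = (extreme d (Br l r) \in indices (child d l r)).
  have e_in := extreme_subst d cs lC.
  have lc : labelled s (child d l r) by case: (d).
  apply/mem_subst/idP => [[j jc ej]|ec]; last by exists (extreme d (Br l r)).
  rewrite (piece_inj cs _ (allP lc _ jc) e_in ej) //.
  exact: (allP lC _ (extreme_mem d _)).
exact: (congr2 andb (key true) (key false)).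
Qed.

Lemma all_well_sided_subst n s C :
    chain 1 n s -> labelled s C ->
  all_well_sided (subst s C) = all_well_sided C.
Proof.
move=> cs; elim: C => [i|l IHl r IHr] lC.
  have i_s := allP lC i (mem_head _ _).
  have /allP/(_ (piece s i)) := chain_all (ltn0Sn 0) cs.
  by rewrite piece_in //; case/(_ isT)/andP.
have := lC; rewrite labelled_Br => /andP[/IHl el /IHr er].
rewrite [subst _ _]/= !all_well_sided_Br el er.
by rewrite -(well_sided_subst cs lC).
Qed.

(** * Decomposition *)

(** The maximal connected subexpressions of A, lone symbols included. *)
Fixpoint cut (A : expr) : seq expr :=
  if connected A then [:: A] else
  if A is Br l r then cut l ++ cut r else [::].

(** The maximal proper ones: A itself is connected when it belongs to L(n). *)
Definition pieces (A : expr) : seq expr :=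
  if A is Br l r then cut l ++ cut r else [::].

Lemma cut_connected A : connected A -> cut A = [:: A].
Proof. by case: A => [i|l r] /= ->. Qed.

Lemma cut_disconnected A : ~~ connected A -> cut A = pieces A.
Proof. by case: A => [i|l r] /= /negPf->. Qed.

Lemma flatten_cut A : flatten (map indices (cut A)) = indices A.
Proof.
elim: A => [i|l IHl r IHr]; first by rewrite cut_connected ?connected_Sym.
case: (boolP (connected (Br l r))) => [/cut_connected->|/cut_disconnected->] /=.
  by rewrite cats0.
by rewrite map_cat flatten_cat IHl IHr.
Qed.

Lemma cut_all A :
  all_well_sided A -> all (fun C => connected C && all_well_sided C) (cut A).
Proof.
elim: A => [i|l IHl r IHr] ws.
  by rewrite cut_connected ?connected_Sym //= connected_Sym.
case: (boolP (connected (Br l r))) => [c|/cut_disconnected->].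
  by rewrite cut_connected //= c ws.
move: ws; rewrite all_well_sided_Br => /and3P[_ /IHl wl /IHr wr].
by rewrite /= all_cat wl wr.
Qed.

(** Disconnected brackets stay disconnected, so that cutting goes down to the
    inserted pieces, and stops there because these are connected. *)
Lemma cut_subst n s C :
    chain 1 n s -> labelled s C -> ~~ has connected (brackets C) ->
  cut (subst s C) = [seq piece s i | i <- indices C].
Proof.
move=> cs; elim: C => [i|l IHl r IHr] lC.
  move=> _; rewrite cut_connected //=.
  have /allP/(_ (piece s i)) := chain_all (ltn0Sn 0) cs.
  by rewrite piece_in ?(allP lC) ?mem_head //; case/(_ isT)/andP.
rewrite [brackets _]/= [has _ _]/= has_cat !negb_or => /and3P[nc ncl ncr].
rewrite cut_disconnected ?(connected_subst cs lC) //=.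
by move: lC; rewrite labelled_Br => /andP[ll lr]; rewrite IHl // IHr // map_cat.
Qed.

(** Inverse of [subst s]: shrinks the members of s back to symbols. *)
Fixpoint skeleton (s : seq expr) (A : expr) : expr :=
  if A \in s then Sym (index A s).+1 else
  if A is Br l r then Br (skeleton s l) (skeleton s r) else A.

Lemma skeleton_mem s A : A \in s -> skeleton s A = Sym (index A s).+1.
Proof. by case: A => [i|l r] /= ->. Qed.

Lemma skeleton_notin s l r :
  Br l r \notin s -> skeleton s (Br l r) = Br (skeleton s l) (skeleton s r).
Proof. by move=> /= /negPf->. Qed.

Lemma skeleton_subst n s C :
    chain 1 n s -> labelled s C -> ~~ has connected (brackets C) ->
  skeleton s (subst s C) = C.
Proof.
move=> cs; elim: C => [i|l IHl r IHr] lC.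
  move=> _; have i_s := allP lC i (mem_head _ _).
  rewrite /= skeleton_mem ?piece_in //; case: i i_s {lC} => // i i_s.
  by rewrite /piece index_uniq // (chain_uniq _ cs).
rewrite [brackets _]/= [has _ _]/= has_cat !negb_or => /and3P[nc ncl ncr].
rewrite [subst _ _]/= skeleton_notin.
  by move: lC; rewrite labelled_Br => /andP[ll lr]; rewrite IHl // IHr.
apply: contra nc => inS; rewrite -(connected_subst cs lC).
by have /allP/(_ _ inS)/andP[] := chain_all (ltn0Sn 0) cs.
Qed.

(** The brackets of the skeleton correspond to the brackets of A that contain
    more than one block; by maximality of the blocks these are disconnected. *)
Lemma skeletonP n s A :
    chain 1 n s -> {subset cut A <= s} ->
  [/\ subst s (skeleton s A) = A,
      indices (skeleton s A) = [seq (index C s).+1 | C <- cut A] &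
      ~~ has connected (brackets (skeleton s A))].
Proof.
move=> cs; elim: A => [i|l IHl r IHr] sub.
  have inS : Sym i \in s.
    by apply: sub; rewrite cut_connected ?connected_Sym ?mem_head.
  by rewrite cut_connected ?connected_Sym // skeleton_mem //= /piece nth_index.
case: (boolP (Br l r \in s)) => inS.
  rewrite cut_connected ?skeleton_mem //= /piece ?nth_index //.
  by have /allP/(_ _ inS)/andP[] := chain_all (ltn0Sn 0) cs.
have nc : ~~ connected (Br l r).
  by apply: contra inS => cA; apply: sub; rewrite cut_connected ?mem_head.
rewrite skeleton_notin // cut_disconnected //.
rewrite cut_disconnected //= in sub.
have [|sl il bl] := IHl.
  by move=> C Cl; apply: sub; rewrite mem_cat Cl.
have [|sr ir br] := IHr.
  by move=> C Cr; apply: sub; rewrite mem_cat Cr orbT.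
have eS : subst s (Br (skeleton s l) (skeleton s r)) = Br l r.
  by rewrite /= sl sr.
have eI : indices (Br (skeleton s l) (skeleton s r)) =
          [seq (index C s).+1 | C <- cut l ++ cut r].
  by rewrite /= il ir map_cat.
split=> //.
rewrite [brackets _]/= [has _ _]/= has_cat !negb_or bl br !andbT.
rewrite -(connected_subst cs) ?eS //.
rewrite /labelled eI; apply/allP=> _ /mapP[C /sub Cs ->].
by rewrite /= index_mem.
Qed.

(** * Primes *)

Lemma prime_expr_Br n l r :
    in_L n (Br l r) ->
  prime_expr (Br l r) = ~~ has connected (brackets l ++ brackets r).
Proof.
case/andP=> /connected_iota c _; rewrite /prime_expr /= c eqseq_cons eqxx /=.
by rewrite has_filter negbK.
Qed.

Lemma mem_P n A : (A \in P n) = in_L n A && prime_expr A.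
Proof. by rewrite -mem_L !inE. Qed.

Lemma in_L_labelled s A : in_L (size s) A -> labelled s A.
Proof.
by case/andP=> pA _; apply/allP=> i; rewrite (perm_mem pA) mem_iota add1n ltnS.
Qed.

Lemma map_piece s : [seq piece s i | i <- iota 1 (size s)] = s.
Proof.
rewrite -[RHS](mkseq_nth (Sym 0)) /mkseq (iotaDl 1 0) -map_comp.
by apply: eq_map => i.
Qed.

Lemma in_L_subst n s p : chain 1 n s -> in_L (size s) p -> in_L n (subst s p).
Proof.
move=> cs pL; have lp := in_L_labelled pL; case/andP: pL => pp wp.
apply/andP; split.
  rewrite indices_subst; apply: perm_trans (chain_perm (ltn0Sn 0) cs).
  rewrite -[in X in perm_eq _ X](map_piece s) -map_comp.
  exact/perm_flatten/perm_map.
by rewrite -[all _ _]/(all_well_sided _) (all_well_sided_subst cs lp).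
Qed.

(** The outer bracket of an element of L(n) is connected without being one of the
    blocks to be shrunk. *)
Definition top_skeleton (s : seq expr) (A : expr) : expr :=
  if A is Br l r then Br (skeleton s l) (skeleton s r) else A.

(** As no proper bracket of a prime expression is connected, the maximal proper
    connected subexpressions of the result are the inserted ones. *)
Lemma prime_subst n s p :
    chain 1 n s -> p \in P (size s) ->
  perm_eq (pieces (subst s p)) s /\
  p = top_skeleton s (subst s p).
Proof.
move=> cs; rewrite mem_P => /andP[pL]; have lp := in_L_labelled pL.
case: p pL lp => // l r pL; rewrite labelled_Br => /andP[ll lr].
rewrite (prime_expr_Br pL) has_cat negb_or => /andP[nl nr].
split; last by rewrite /= !(skeleton_subst cs).
rewrite /= (cut_subst cs) // (cut_subst cs) // -map_cat.
rewrite -[X in perm_eq _ X]map_piece.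
by apply: perm_map; case/andP: pL.
Qed.

Lemma subst_inj n s s' p p' :
    chain 1 n s -> p \in P (size s) -> chain 1 n s' -> p' \in P (size s') ->
  subst s p = subst s' p' -> p = p' /\ s = s'.
Proof.
move=> cs pP cs' pP' eqS.
have [ps ep] := prime_subst cs pP; have [ps' ep'] := prime_subst cs' pP'.
have es : s = s'.
  apply: (chain_mem_eq _ _ cs cs') => // A.
  by rewrite -(perm_mem ps) eqS (perm_mem ps').
by split=> //; rewrite ep ep' eqS es.
Qed.

(** The chain is the sorted list of maximal proper connected subexpressions. *)
Lemma subst_surj n A :
    1 < n -> in_L n A ->
  exists s, exists2 p, chain 1 n s /\ p \in P (size s) & subst s p = A.
Proof.
move=> n1 AL; case: A AL => [i|l r] AL.
  by case/andP: AL => /perm_size; rewrite size_iota /=; lia.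
have [pA wA] := andP AL.
pose s := sort (relpre min_index leq) (pieces (Br l r)).
have ps : perm_eq s (pieces (Br l r)) by rewrite perm_sort.
have fl : flatten (map indices (pieces (Br l r))) = indices (Br l r).
  by rewrite /= map_cat flatten_cat !flatten_cut.
have cs : chain 1 n s.
  apply: chain_intro => //.
  - apply: perm_trans pA; rewrite -fl; exact/perm_flatten/perm_map.
  - rewrite (perm_all _ ps) /= all_cat.
    move: wA; rewrite -/(all_well_sided _) all_well_sided_Br.
    by case/and3P=> [_ /cut_all-> /cut_all->].
  - by apply: sort_sorted => B C /=; apply: leq_total.
have subl : {subset cut l <= s}.
  by move=> C Cl; rewrite (perm_mem ps) mem_cat Cl.
have subr : {subset cut r <= s}.
  by move=> C Cr; rewrite (perm_mem ps) mem_cat Cr orbT.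
have [sl il bl] := skeletonP cs subl; have [sr ir br] := skeletonP cs subr.
pose p := Br (skeleton s l) (skeleton s r).
have ip : indices p = [seq (index C s).+1 | C <- pieces (Br l r)].
  by rewrite /= il ir map_cat.
have pp : perm_eq (indices p) (iota 1 (size s)).
  rewrite ip -(permPl (perm_map _ ps)) (iotaDl 1 0).
  rewrite (map_comp (addn 1) (index^~ s)) (_ : map _ s = iota 0 (size s)) //.
  apply: (@eq_from_nth _ 0); rewrite size_map ?size_iota // => i i_s.
  by rewrite (nth_map (Sym 0)) // index_uniq ?nth_iota // (chain_uniq _ cs).
have eS : subst s p = Br l r by rewrite /= sl sr.
have pL : in_L (size s) p.
  have lp : labelled s p.
    by apply/allP=> i; rewrite (perm_mem pp) mem_iota add1n ltnS.
  rewrite /in_L pp -[all _ _]/(all_well_sided p).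
  by rewrite -(all_well_sided_subst cs lp) eS.
exists s, p => //; split=> //.
by rewrite mem_P pL (prime_expr_Br pL) has_cat negb_or bl.
Qed.

(** * Counting *)

Fixpoint chains (k m n : nat) : seq (seq expr) :=
  if k is k'.+1 then
    flatten [seq [seq A :: s | A <- L_at m j, s <- chains k' (m + j) (n - j)]
            | j <- iota 1 n]
  else if n == 0 then [:: [::]] else [::].

Lemma mem_chains k m n s :
  0 < m -> (s \in chains k m n) = (size s == k) && chain m n s.
Proof.
elim: k m n s => [|k IH] m n s m0 /=.
  by case: eqP => [->|/eqP n0]; case: s => [|A s] //=; case: eqP n0.
apply/flatten_mapP/andP => [[j]|].
  rewrite mem_iota => j_n /allpairsP[[A s'] /= [AL]].
  rewrite IH; last lia.
  case/andP=> /eqP<- cs -> /=; split=> //.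
  have : A \in L_at m j by [].
  rewrite mem_L_at // => /andP[/perm_size + _]; rewrite size_iota => ej.
  by rewrite ej AL cs; lia.
case: s => [[]//|A s [/= ks /and3P[jn AL cs]]].
exists (size (indices A)).
  by rewrite mem_iota; have := size_indices_gt0 A; lia.
apply/allpairsP; exists (A, s); split=> //=.
by rewrite IH ?cs ?andbT //; lia.
Qed.

Lemma uniq_chains k m n : 0 < m -> uniq (chains k m n).
Proof.
elim: k m n => [|k IH] m n m0 /=; first by case: eqP.
pose first_at j :=
  [seq A :: s | A <- L_at m j, s <- chains k (m + j) (n - j)].
rewrite -[flatten _](_ : [seq s | j <- iota 1 n, s <- first_at j] = _);
  last by congr flatten; apply: eq_map => j; rewrite map_id.
apply: allpairs_uniq_dep => [|j j_n|]; first exact: iota_uniq.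
  apply: allpairs_uniq; rewrite ?fset_uniq ?IH //; first lia.
  by move=> [A s] [A' s'] _ _ /= [-> ->].
have szj j s : s \in first_at j -> size (indices (head (Sym 0) s)) = j.
  case/allpairsP=> [[A s'] /= [AL _ ->]] /=.
  have : A \in L_at m j by [].
  by rewrite mem_L_at // => /andP[/perm_size + _]; rewrite size_iota.
move=> _ _ /allpairsPdep[j [s [_ sj ->]]]
  /allpairsPdep[j' [s' [_ sj' ->]]] /= es.
by move: (szj _ _ sj) (szj _ _ sj') => <- <-; rewrite es.
Qed.

Lemma size_chains0 m n : size (chains 0 m n) = (n == 0).
Proof. by rewrite /=; case: eqP. Qed.

Lemma size_chainsS k m n : 0 < m ->
  size (chains k.+1 m n) =
    \sum_(j <- iota 1 n) j.-1`! * size (chains k (m + j) (n - j)).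
Proof.
move=> m0; rewrite /= size_flatten /shape -map_comp sumnE big_map.
apply: eq_big_seq => j; rewrite mem_iota => j_n /=.
by rewrite size_allpairs -(card_L_at _ m0) prednK //; lia.
Qed.

Lemma prime_size k p : p \in P k -> 1 < k.
Proof.
rewrite mem_P; case: p => [i|l r] /andP[/andP[/perm_size + _] //].
rewrite size_iota /= size_cat.
by have := size_indices_gt0 l; have := size_indices_gt0 r; lia.
Qed.

(** The free generation of L by P, as a count.  The bound K may exceed n: there
    is no chain of more than n expressions on n labels.  Bounding all the sums
    by the same K is what makes them coefficients of one polynomial. *)
Lemma card_L_primes n K : 1 < n <= K ->
  n.-1`! = \sum_(k < K.+1) b k * size (chains k 1 n).
Proof.
case/andP=> n1 nK; rewrite -(card_L_at n.-1 (ltn0Sn 0)) prednK; last lia.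
rewrite L_at1.
(* A pair (p, s) determines the arity k = size s, so the union over k of the
   lists of pairs has no repetition. *)
pose prs k := [seq (p, s) | p <- P k, s <- chains k 1 n].
have prsP k p s : (p, s) \in prs k -> [/\ p \in P k, size s = k & chain 1 n s].
  case/allpairsP=> [[p' s'] /= [pP + [-> ->]]].
  by rewrite mem_chains // => /andP[/eqP].
pose T := [seq subst ps.2 ps.1 | k <- iota 0 K.+1, ps <- prs k].
have -> : #|` L n| = size T.
  apply/perm_size/uniq_perm; first exact: fset_uniq.
    apply: allpairs_uniq_dep => [|k _|]; first exact: iota_uniq.
      apply: allpairs_uniq; rewrite ?fset_uniq ?uniq_chains //.
      by move=> [p s] [p' s'] _ _.
    move=> _ _ /allpairsPdep[k [[p s] [_ /prsP[pP sk cs] ->]]]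
      /allpairsPdep[k' [[p' s'] [_ /prsP[pP' sk' cs'] ->]]] /=.
    by subst k k' => /(subst_inj cs pP cs' pP')[-> ->].
  move=> A; apply/idP/allpairsPdep
    => [AL|[k [[p s] [_ /prsP[pP sk cs] -> /=]]]].
    have : A \in L n by [].
    rewrite mem_L => /(subst_surj n1)[s [p [cs pP] <-]].
    exists (size s), (p, s); split=> //.
      rewrite mem_iota /=.
      have : size s <= size (flatten (map indices s)).
        elim: (s) => //= B s' IH; rewrite size_cat.
        by have := size_indices_gt0 B; lia.
      rewrite (perm_size (chain_perm (ltn0Sn 0) cs)) size_iota; lia.
    apply/allpairsP; exists (p, s); split=> //=.
    by rewrite mem_chains // eqxx.
  have : subst s p \in L n; last by [].
  rewrite mem_L; apply: in_L_subst => //.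
  by move: pP; rewrite -sk mem_P => /andP[].
rewrite /T size_allpairs_dep sumnE big_map.
rewrite -{1}[iota 0 K.+1]/(index_iota 0 K.+1) big_mkord.
by apply: eq_bigr => k _; rewrite size_allpairs.
Qed.

(** * The differential equation *)

Import GRing.Theory Num.Theory.
Local Open Scope ring_scope.

Lemma chains_small k m n : (0 < m)%N -> (n < k)%N -> chains k m n = [::].
Proof.
move=> m0 nk; apply: size0nil; elim: k m n m0 nk => // k IH m n m0 nk.
rewrite size_chainsS // big_seq big1 // => j; rewrite mem_iota => j_n.
by rewrite IH ?muln0 //; lia.
Qed.

Lemma size_chains1 m n : (0 < m)%N -> size (chains 1 m n.+1) = (n`!)%N.
Proof.
move=> m0; rewrite size_chainsS // -(addn1 n) iotaD big_cat /= big_seq big1.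
  by rewrite big_seq1 add1n addn1 subnn muln1 add0n.
move=> j; rewrite mem_iota => j_n.
by case: eqP => //; [lia | rewrite muln0].
Qed.

Lemma b_small k : (k < 2)%N -> b k = 0%N.
Proof.
move=> k2; apply/eqP; rewrite cardfs_eq0; apply/eqP/fsetP=> p; rewrite in_fset0.
by apply/negP=> /prime_size; lia.
Qed.

Lemma BseriesE k : Bseries k = (b k)%:R - (k == 1)%:R.
Proof.
by case: k => [|[|k]]; first [by rewrite b_small | by rewrite /= natz subr0].
Qed.

(** The truncations of A(x) and B(x).  As 0 - 1 is 0 on naturals, the constant
    term of A needs the factor [0 < i] to vanish. *)
Definition Lpoly (N : nat) : {poly int} :=
  \poly_(i < N) ((0 < i)%N * i.-1`!)%:R.
Definition Bpoly (N : nat) : {poly int} := \poly_(i < N) Bseries i.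

(** A chain is its first expression followed by a shorter chain, so that the
    numbers of chains are iterated convolutions of the numbers |L(n)|. *)
Lemma coef_Lpoly_exp N k m n :
  (0 < m)%N -> (n < N)%N -> (Lpoly N ^+ k)`_n = (size (chains k m n))%:R.
Proof.
elim: k m n => [|k IH] m n m0 nN; first by rewrite expr0 coef1 size_chains0.
rewrite exprS coefM size_chainsS // natr_sum big_ord_recl coef_poly /= mul0n.
rewrite if_same mul0r add0r (iotaDl 1 0) big_map.
have -> : iota 0 n = index_iota 0 n by rewrite /index_iota subn0.
rewrite big_mkord.
apply: eq_bigr => i _; have i_n := ltn_ord i.
rewrite /bump leq0n !add1n coef_poly (leq_ltn_trans i_n nN) mul1n.
by rewrite natrM (IH (m + i.+1)%N) //; lia.
Qed.

(** B(A(x)) = -x: for n >= 2 this is [card_L_primes], and for n < 2 only the term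
    -x of B contributes. *)
Lemma coef_comp_Bpoly N n :
  (n < N)%N -> (Bpoly N \Po Lpoly N)`_n = - (n == 1)%:R.
Proof.
move=> nN; rewrite /Bpoly poly_def raddf_sum coef_sum /=.
under eq_bigr => k _.
  rewrite comp_polyZ comp_Xn_poly coefZ (@coef_Lpoly_exp _ _ 1) //.
  rewrite BseriesE mulrBl -natrM.
  over.
rewrite sumrB -natr_sum.
have -> : \sum_(k < N) (k == 1 :> nat)%:R * (size (chains k 1 n))%:R =
          ((0 < n)%N * n.-1`!)%:R :> int.
  case: n nN => [|n] nN.
    rewrite big1 // => k _.
    by case: eqP => [->|_]; rewrite ?mul0r // chains_small ?mulr0.
  have N1 : (1 < N)%N by lia.
  rewrite (bigD1 (Ordinal N1)) //= big1 => [|k].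
    by rewrite addr0 mul1r size_chains1 ?mul1n.
  by rewrite -val_eqE /= => /negPf->; rewrite mul0r.
case: N nN => // K nK; case: (ltnP 1 n) => n1.
  rewrite -card_L_primes; last by rewrite n1.
  rewrite (ltnW n1) mul1n subrr.
  by case: n n1 {nK} => [|[|n]] //=; rewrite oppr0.
rewrite big1 ?add0r; first by case: n n1 {nK} => [|[|n]].
move=> k _; case: (ltnP k 2) => k2; first by rewrite b_small.
by rewrite chains_small ?muln0 //; lia.
Qed.

(** The identity A = x + x^2 A' says that n! = n (n-1)!. *)
Lemma coef_Lpoly_ODE N n :
  (n < N)%N -> (Lpoly N)`_n = ('X + 'X^2 * (Lpoly N)^`())`_n.
Proof.
move=> nN; rewrite coefD coefX coefXnM coef_deriv !coef_poly nN.
case: n nN => [|[|n]] nN //=; rewrite ?addr0 //.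
rewrite subSS subn1 /= (ltnW nN) !mul1n add0r -mulrnA.
by rewrite factS mulnC.
Qed.

Lemma low_coef0_mulXn (p : {poly int}) M :
  (forall n, (n < M)%N -> p`_n = 0) -> exists r : {poly int}, p = r * 'X^M.
Proof.
move=> p0; exists (drop_poly M p); rewrite -[LHS](poly_take_drop M).
suff -> : take_poly M p = 0 by rewrite add0r.
by apply/polyP=> i; rewrite coef_take_poly coef0; case: ifP => // /p0.
Qed.

(** Substituting a series of order one preserves the order of vanishing.  The
    extra unit factor q absorbs one factor u at each step of the induction. *)
Lemma comp_low_coef0 (p q u r : {poly int}) M :
    u.[0] = 1 -> q.[0] = 1 -> (p \Po ('X * u)) * q = r * 'X^M ->
  forall n, (n < M)%N -> p`_n = 0.
Proof.
elim: M p q => // M IH p q u0 q0 eqp.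
have p0 : p.[0] = 0.
  have := congr1 (horner^~ 0) eqp.
  by rewrite !hornerE horner_comp !hornerE q0 /= exprS mul0r mulr0 mulr1.
have /factor_theorem[p1 ep] : root p 0 by apply/rootP.
move: ep; rewrite subr0 => ep.
have eqp1 : (p1 \Po ('X * u)) * (u * q) = r * 'X^M.
  apply: (@mulfI _ 'X); first by rewrite polyX_eq0.
  move: eqp.
  by rewrite ep comp_polyM comp_polyX exprS [RHS]mulrCA => <-; ring.
move=> [|n] nM; first by rewrite -horner_coef0.
by rewrite ep coefMX /=; apply: (IH _ _ u0 _ eqp1); rewrite ?hornerM ?u0 ?q0.
Qed.

(** One order is lost by differentiating, whence the bound on n. *)
Lemma Bpoly_ODE N n : (n.+1 < N)%N ->
  ('X * (Bpoly N)^`() + ((Bpoly N)^`() + Bpoly N) * Bpoly N)`_n = 0.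
Proof.
case: N => // M; rewrite ltnS => nM.
set be := Bpoly _; pose al := Lpoly M.+1.
have [r er] : exists r : {poly int}, be \Po al + 'X = r * 'X^(M.+1).
  apply: low_coef0_mulXn => i iM; rewrite coefD coefX coef_comp_Bpoly //.
  by rewrite addNr.
have [r2 er2] : exists r : {poly int},
    al - ('X + 'X^2 * al^`()) = r * 'X^(M.+1).
  by apply: low_coef0_mulXn => i iM; rewrite coefB coef_Lpoly_ODE // subrr.
have er3 : (be^`() \Po al) * al^`() + 1 = (r^`() * 'X + r *+ M.+1) * 'X^M.
  have := congr1 (@deriv _) er; rewrite derivD deriv_comp derivX derivM derivXn.
  by rewrite exprS => ->; rewrite mulrDl mulrA mulrnAr mulrnAl.
have [u eu] : exists u, al = 'X * u.
  have [|u] := @low_coef0_mulXn al 1; last by exists u; rewrite mulrC.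
  by case=> // _; rewrite coef_poly.
have u0 : u.[0] = al`_1 by rewrite eu mulrC coefMX horner_coef0.
have al1 : al`_1 = 1 by rewrite coef_poly; case: (M) nM.
suff [r4 er4] : exists r : {poly int},
    (('X * be^`() + (be^`() + be) * be) \Po al) * al^`() = r * 'X^M.
  apply: (@comp_low_coef0 _ al^`() u r4 M); rewrite -?eu //.
    by rewrite u0 al1.
  by rewrite horner_coef0 coef_deriv al1.
rewrite comp_polyD !comp_polyM comp_polyD comp_polyX.
move: er er2 er3.
set e := be \Po al; set D := be^`() \Po al.
set d := al^`(); set r3 := _ + _ *+ _.
rewrite exprS => er er2 er3; set Y := 'X^M in er er2 er3 *.
(* Up to multiples of Y, D d = -1, e = -x and al = x + x^2 d, hence the left-hand
   side is - al - e + e^2 d = 0. *)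
clearbody e D d r3 Y => {eu u0 al1}; clearbody al.
have eD : D * d = r3 * Y - 1 by rewrite -er3 addrK.
have ee : e = r * ('X * Y) - 'X by rewrite -er addrK.
have ea : al = 'X + 'X^2 * d + r2 * ('X * Y) by rewrite -er2 addrC subrK.
rewrite (_ : _ * d = (al + e) * (D * d) + e * e * d); last by ring.
exists ((al + e) * r3 - (r + r2) * 'X + (e - 'X) * r * 'X * d).
by rewrite eD ee ea; ring.
Qed.

Lemma Bseries_ODE :
  ('X * Bseries^`() + (Bseries^`() + Bseries) * Bseries =1 0)%fps.
Proof.
move=> n; rewrite -[RHS](@Bpoly_ODE n.+2 n) // coefD !coefM.
by congr (_ + _); apply: eq_bigr => i _; have i_n := ltn_ord i;
  rewrite ?coefD ?coefX ?coef_deriv !coef_poly //; rewrite !ifT //; lia.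
Qed.

Lemma Bseries_recursion n : (0 < n)%N ->
  Bseries n *+ n
    + \sum_(0 <= i < n.+1)
        (Bseries i.+1 *+ i.+1 + Bseries i) * Bseries (n - i)%N = 0.
Proof.
case: n => // n _; rewrite big_mkord -[RHS](Bseries_ODE n.+1).
congr (_ + _); rewrite /fps_mul !big_ord_recl big1 => [|i _].
  by rewrite /fps_X /fps_deriv /= mul0r mul1r add0r addr0 /bump subn1.
by rewrite /fps_X mul0r.
Qed.

Lemma b_2 : b 2 = 1%N.
Proof.
have := Bseries_recursion (ltn0Sn 1).
rewrite !big_nat_recl // big_geq // /Bseries /= subn0 !mulr2n.
by rewrite mulr1n mulr0 !addr0 mulN1r mulrN1; lia.
Qed.

(** In the coefficient of x^n, the term n b_n of x B' and the terms k = 0, 1,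
    n - 1 and n of the product add up to
    n b_n - b_n + (2 b_2 - 1) b_(n-1) - (n b_n + b_(n-1)) + 0, which is - b_n. *)
Lemma b_recursion n : (3 <= n)%N ->
  b n = (\sum_(2 <= k < (n - 2).+1) ((k + 1) * b (k + 1) + b k) * b (n - k))%N.
Proof.
case: n => [|[|[|m]]] // _.
apply/eqP; rewrite -(eqr_nat int) natr_sum; apply/eqP.
rewrite subSS subn1 /= big_add1 big_add1 /=.
under eq_big_nat => i i_m.
  rewrite natrM natrD natrM !addn1 subSS.
  over.
have := Bseries_recursion (ltn0Sn m.+2).
rewrite big_nat_recr // big_nat_recr // big_nat_recl // big_nat_recl //=.
rewrite subn0 subnn subSnn subSS subn0 b_2.
set S := \sum_(0 <= i < m) _; set S' := \sum_(0 <= i < m) _.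
have -> : S = S'.
  apply: eq_big_nat => i i_m; rewrite -mulr_natl !natz subSS BseriesE natz.
  by rewrite (_ : (_ == 1)%N = false) ?subr0 //; lia.
rewrite [Bseries 1]/= [Bseries 0]/= mulr0 addr0 mulr1n addr0 natz => e.
apply/eqP; rewrite -subr_eq0 -[X in _ == X]oppr0 -e; apply/eqP; ring.
Qed.

Theorem theorem9 :
  ('X * Bseries^`() + (Bseries^`() + Bseries) * Bseries =1 0)%fps
  /\ b 2 = 1%N
  /\ (forall n : nat, (3 <= n)%N ->
        b n = (\sum_(2 <= k < (n - 2).+1)
                 ((k + 1) * b (k + 1) + b k) * b (n - k))%N).
Proof.
by split; [exact: Bseries_ODE | split; [exact: b_2 | exact: b_recursion]].
Qed.
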